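(* Let $K$ be a bounded subset of $\mathbb{R}^3$ such that for each direction $\theta\in\mathcal{E}$ the set $K$ contains a circle $C_\theta$ of direction $\theta$ and of some radius $r(\theta)>0$. Then the Hausdorff dimension of $K$ satisfies $$\dim_H(K)\ge 2.$$
   Context: A circle $C$ in $\mathbb{R}^3$ is the boundary $C=\partial D$ of a two-dimensional planar disc $D$; the direction of $C$ is the normal direction to (the plane containing) $D$. A line (the North-South line) through the origin of $\mathbb{R}^3$ is fixed, and $\mathcal{E}$ (the equator) denotes the set of all directions (unit vectors) $\theta$ perpendicular to this line. The centers of the circles $C_\theta$ are arbitrary and may depend on $\theta$, and so may the radii $r(\theta)$. $\dim_H$ denotes Hausdorff dimension. *)

(* Defs.v *)
From HB Require Import structures.
From mathcomp Require Export all_boot all_order all_algebra.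
From mathcomp Require Export all_classical all_reals all_analysis.

Set Implicit Arguments.
Unset Strict Implicit.
Unset Printing Implicit Defensive.

Import Order.TTheory GRing.Theory Num.Theory numFieldNormedType.Exports.

Local Open Scope classical_set_scope.
Local Open Scope ring_scope.

(* The norm `|x| that the library puts on 'rV[R]_n is the sup norm, so the
   Euclidean structure of R^n is defined here. *)
Definition dot (R : realType) (n : nat) (x y : 'rV[R]_n) : R :=
  \sum_(i < n) x ord0 i * y ord0 i.

Definition enorm (R : realType) (n : nat) (x : 'rV[R]_n) : R :=
  Num.sqrt (dot x x).

(* The element 0 is added so that the empty set has diameter 0 (the supremum
   of the empty set is -oo). *)
Definition diam (R : realType) (n : nat) (U : set 'rV[R]_n) : \bar R :=
  ereal_sup (0%E |` [set (enorm (x - y))%:E | x in U & y in U]).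

(* diam(U)^s. The case distinction only matters for s = 0, where 0 `^ 0 = 1:
   empty members of a covering sequence must not contribute. *)
Definition diam_pow (R : realType) (n : nat) (s : R) (U : set 'rV[R]_n)
    : \bar R :=
  if U == set0 then 0%E else (diam U `^ s)%E.

(* Coverings are countable; a finite covering is padded with empty sets. *)
Definition hausdorff_content (R : realType) (n : nat) (s delta : R)
    (K : set 'rV[R]_n) : \bar R :=
  ereal_inf [set (\sum_(0 <= i <oo) diam_pow s (U i))%E |
    U in [set U : (set 'rV[R]_n)^nat |
      K `<=` \bigcup_i U i /\ forall i, (diam (U i) <= delta%:E)%E]].

(* hausdorff_content is nonincreasing in delta: this supremum is its limit as
   delta tends to 0. *)
Definition hausdorff_measure (R : realType) (n : nat) (s : R)
    (K : set 'rV[R]_n) : \bar R :=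
  ereal_sup [set hausdorff_content s delta K | delta in [set d : R | 0 < d]].

Definition hausdorff_dim (R : realType) (n : nat) (K : set 'rV[R]_n)
    : \bar R :=
  ereal_inf [set s%:E | s in
    [set s : R | 0 <= s /\ hausdorff_measure s K = 0%E]].

(* The equator with respect to the North-South line R v, where v != 0. *)
Definition equator (R : realType) (v : 'rV[R]_3) : set 'rV[R]_3 :=
  [set theta | enorm theta = 1 /\ dot theta v = 0].

(* The boundary, in the plane through c orthogonal to theta, of the disc
   { x | dot (x - c) theta = 0 /\ enorm (x - c) <= r }; theta is a unit
   vector and r > 0. *)
Definition circle (R : realType) (c theta : 'rV[R]_3) (r : R)
    : set 'rV[R]_3 :=
  [set x | dot (x - c) theta = 0 /\ enorm (x - c) = r].

(* Main.v *)
(* Project K orthogonally onto the plane perpendicular to the North-South line.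
   The circle C_theta becomes a segment perpendicular to theta, so the image
   contains a segment in every direction, and by (a version for segments of
   variable length of) Davies' theorem it has dimension 2; projections do not
   increase dimension.

   Davies' theorem is proved by Cordoba's argument.  If H^s(K) = 0 with s < 2,
   then K is covered by at most 5 * 2^(s k) sets of diameter at most 2^-k, with
   k running over all large integers.  By pigeonhole, the segment of each slope
   m has a scale k at which it meets at least c z^k 2^k of the dyadic cells of
   side 2^-k used by the cover, where z < 1 is close to 1.  Lines whose slopes
   differ by d share O(1/d) cells, so Cauchy-Schwarz bounds the number of
   2^-k-separated slopes attached to the scale k; summing over k, the set of all
   slopes with a segment over a fixed interval is negligible.  There are only
   countably many rational intervals, yet all slopes in [0, 1) must occur. *)
Require Import Defs.
From mathcomp Require Import all_boot all_order all_algebra finmap.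
From mathcomp Require Import all_classical all_reals all_analysis.
From mathcomp Require Import zify ring lra.
Import Order.TTheory GRing.Theory Num.Theory.
Import numFieldNormedType.Exports.
Set Implicit Arguments.
Unset Strict Implicit.
Unset Printing Implicit Defensive.
Local Open Scope classical_set_scope.
Local Open Scope ring_scope.

(** * Harmonic sums and Cauchy-Schwarz *)

(** Each dyadic block from [2 ^ k] to [2 ^ k.+1] contributes at most 1. This is the logarithmic loss
    in Cordoba's argument. *)
Lemma sum_inv_le (R : realFieldType) (k : nat) :
  \sum_(0 <= i < 2 ^ k) i.+1%:R^-1 <= k.+1%:R :> R.
Proof.
elim: k => [|k IHk]; first by rewrite big_nat1 invr1.
rewrite (big_cat_nat (leq0n (2 ^ k)%N)) /=; last by rewrite leq_exp2l.
rewrite -[k.+2%:R]natr1 lerD //.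
apply: (@le_trans _ _ (\sum_(2 ^ k <= i < 2 ^ k.+1) ((2 ^ k)%N%:R^-1 : R))).
  rewrite big_nat_cond [leRHS]big_nat_cond; apply: ler_sum => i /andP[/andP[ki _] _].
  by rewrite lef_pV2 ?posrE ?ltr0n ?expn_gt0 // ler_nat (leq_trans ki).
rewrite sumr_const_nat expnS mul2n -addnn addnK -[_ *+ _]mulr_natr.
by rewrite mulVf ?pnatr_eq0 ?expn_eq0.
Qed.

(** Truncated subtraction makes [(i - j) + (j - i)] the distance |i - j|. The terms up to [j] and
    those after [j] are each dominated by an initial piece of the harmonic sum. *)
Lemma sum_inv_dist_le (R : realFieldType) (j n : nat) : (j < n)%N ->
  \sum_(0 <= i < n) ((i - j) + (j - i)).+1%:R^-1
    <= 2 * \sum_(0 <= i < n) i.+1%:R^-1 :> R.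
Proof.
move=> jn; rewrite (big_cat_nat (leq0n j.+1)) //=.
have -> : 2 * \sum_(0 <= i < n) i.+1%:R^-1 =
  \sum_(0 <= i < n) i.+1%:R^-1 + \sum_(0 <= i < n) i.+1%:R^-1 :> R by ring.
apply: lerD.
- rewrite big_nat_rev /= [leRHS](big_cat_nat (leq0n j.+1)) //=.
  rewrite -[leLHS]addr0; apply: lerD;
    last by apply: sumr_ge0 => i _; rewrite invr_ge0 ler0n.
  rewrite big_nat_cond [leRHS]big_nat_cond le_eqVlt; apply/orP; left; apply/eqP.
  apply: eq_bigr => i /andP[/andP[_ ij] _]; congr (_%:R^-1); lia.
- rewrite -{1}[j.+1]add0n big_addn.
  rewrite [leRHS](big_cat_nat (leq0n (n - j.+1)%N)) /=; last exact: leq_subr.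
  rewrite -[leLHS]addr0; apply: lerD;
    last by apply: sumr_ge0 => i _; rewrite invr_ge0 ler0n.
  apply: ler_sum => i _; rewrite lef_pV2 ?posrE ?ltr0n // ler_nat; lia.
Qed.

Lemma sqr_sum_le (R : realFieldType) (T : Type) (s : seq T) (f : T -> R) :
  (\sum_(c <- s) f c) ^+ 2 <= (size s)%:R * \sum_(c <- s) f c ^+ 2.
Proof.
elim: s => [|c s IHs]; first by rewrite !big_nil expr0n mul0r.
rewrite !big_cons /=; set S := \sum_(_ <- s) f _ in IHs *.
set Q := \sum_(_ <- s) _ in IHs *.
have Q0 : 0 <= Q by apply: sumr_ge0 => i _; exact: sqr_ge0.
have [s0|s0] := posnP (size s).
  rewrite s0 mul0r in IHs; have S0 : S = 0.
    by apply/eqP; rewrite -sqrf_eq0 eq_le IHs sqr_ge0.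
  by rewrite s0 mul1r S0 addr0 lerDl.
have n0 : 0 < (size s)%:R :> R by rewrite ltr0n.
rewrite -natr1; set n := (size s)%:R in IHs n0 *.
(* After multiplication by n this follows from (n f c - S)^2 >= 0 and the induction hypothesis S^2
   <= n Q. *)
have h : 2 * f c * S <= n * f c ^+ 2 + Q.
  rewrite -(ler_pM2l n0); have := sqr_ge0 (n * f c - S); nra.
nra.
Qed.

(** * Cells common to two lines, and Cordoba's count *)

(** There are at most 2T columns, and each holds at most nine admissible integers: their offsets
    from the floor of [g] lie between -4 and 4. *)
Lemma size_graph_nbhd_le (R : archiRealFieldType) (s : seq (int * int)) (T : nat)
    (u0 : int) (g : int -> R) :
  uniq s ->
  (forall c, c \in s -> (`|c.1 - u0| < T)%N /\ `|g c.1 - c.2%:~R| <= 4) ->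
  (size s <= 18 * T)%N.
Proof.
move=> us hs.
pose f (c : int * int) :=
  (absz (c.1 - u0 + T%:Z), absz (c.2 - Num.floor (g c.1) + 4)).
have hw c : c \in s -> (-4 <= c.2 - Num.floor (g c.1) <= 4)%R.
  move=> /hs[_]; have /andP[] := floor_itv (g c.1).
  set z := Num.floor _ => h1 h2; rewrite ler_norml => /andP[h3 h4].
  have : ((z - 5)%:~R : R) < c.2%:~R by rewrite rmorphB /=; lra.
  have : (c.2%:~R : R) < (z + 5)%:~R by rewrite !rmorphD /= in h2 *; lra.
  rewrite !ltr_int; lia.
have injf : {in s &, injective f}.
  move=> [u w] [u' w'] cs cs' [/= e1 e2].
  have /= [hu _] := hs _ cs; have /= [hu' _] := hs _ cs'.
  have uu : u = u' by lia.
  have /= := hw _ cs; have /= := hw _ cs'; rewrite -uu in e2 *.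
  set z := Num.floor _ in e2 *; move=> a1 a2.
  by rewrite uu; congr pair; change (w = w' :> int); lia.
have -> : size s = size (map f s) by rewrite size_map.
have -> : (18 * T)%N = size (allpairs pair (iota 0 (2 * T)) (iota 0 9)).
  rewrite size_allpairs !size_iota; lia.
apply: uniq_leq_size; first by rewrite map_inj_in_uniq.
move=> _ /mapP[[u w] cs ->]; apply/allpairsP.
have /= [hu _] := hs _ cs; have /= hz := hw _ cs.
exists (f (u, w)); rewrite -surjective_pairing.
split=> //; [|change ((f (u, w)).2 \in iota 0 9)]; rewrite mem_iota add0n leq0n /f /=.
- lia.
- by move: hz; set z := Num.floor _; lia.
Qed.

(* The integer pair c stands for the cell with corner 2^-k c; the conditions
   hold whenever the segment y = m x + b, p <= x <= q, |m| <= 1, meets that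
   cell enlarged by 2^-k. *)
Definition meets_cell (R : archiRealFieldType) (k : nat) (p q m b : R)
    (c : int * int) : bool :=
  [&& `|m * c.1%:~R + b * 2 ^+ k - c.2%:~R| <= 4,
      p * 2 ^+ k - 2 <= c.1%:~R & c.1%:~R <= q * 2 ^+ k + 2].

(** Subtracting the conditions of both lines at both cells eliminates the intercepts and leaves |(m
    - m')(u - u')| <= 16 for the columns u, u'. Slopes far apart therefore force the columns to be
    close. *)
Lemma common_cells_dist (R : archiRealFieldType) (k i j : nat)
    (p q m b m' b' : R) (c c' : int * int) :
  q - p <= 1 -> (i < 2 ^ k)%N -> (j < 2 ^ k)%N ->
  i%:R <= m * 2 ^+ k <= i.+1%:R -> j%:R <= m' * 2 ^+ k <= j.+1%:R ->
  meets_cell k p q m b c -> meets_cell k p q m' b' c ->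
  meets_cell k p q m b c' -> meets_cell k p q m' b' c' ->
  (((i - j) + (j - i)).+1 * (absz (c.1 - c'.1)%R).+1 <= 49 * 2 ^ k)%N.
Proof.
move=> pq ik jk /andP[mi mi'] /andP[mj mj'].
move=> /and3P[h1 h2 h3] /and3P[h4 _ _] /and3P[h1' h2' h3'] /and3P[h4' _ _].
set N := (2 ^ k)%N in ik jk *; have N0 : (0 < N)%N by rewrite expn_gt0.
have NE : 2 ^+ k = N%:R :> R by rewrite /N natrX.
rewrite NE in mi mi' mj mj' h1 h2 h3 h4 h1' h2' h3' h4'.
set D := absz _.
have DE : (D%:R : R) = `|c.1%:~R - c'.1%:~R|.
  by rewrite /D natr_absz intr_norm rmorphB.
set n := (i - j + (j - i))%N.
have hD : (D <= N + 4)%N.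
  rewrite -(@ler_nat R) natrD DE; rewrite ler_norml.
  have : q * N%:R - p * N%:R <= N%:R.
    rewrite -mulrBl; apply: ler_piMl => //; exact: ler0n.
  by move: h2 h3 h2' h3'; clear; move=> *; apply/andP; split; lra.
(* The dyadic slots of the two slopes are [n] apart; the positions inside the slots cost at most
   1. *)
have hm : (n%:R - 1) <= `|(m - m') * N%:R|.
  have [ij|ji] := leqP i j.
    have -> : n = (j - i)%N by rewrite /n; move: ij; clear; lia.
    rewrite natrB // ler_normr; apply/orP; right.
    by move: mi' mj; rewrite -natr1; clear; lra.
  have -> : n = (i - j)%N by rewrite /n; move: ji; clear; lia.
  rewrite natrB ?(ltnW ji) // ler_normr; apply/orP; left.
  by move: mi mj'; rewrite -natr1; clear; lra.
have h16 : `|(m - m') * (c.1%:~R - c'.1%:~R)| <= 16.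
  move: h1 h4 h1' h4'; rewrite !ler_norml.
  clear; move=> /andP[? ?] /andP[? ?] /andP[? ?] /andP[? ?].
  by apply/andP; split; lra.
have hnD : ((n - 1) * D <= 16 * N)%N.
  rewrite -(@ler_nat R) !natrM DE.
  have [n1|n1] := leqP n 1.
    by rewrite (eqP (n1 : (n - 1 == 0)%N)) mul0r mulr_ge0 ?ler0n.
  rewrite natrB ?(ltnW n1) //.
  apply: (@le_trans _ _ (`|(m - m') * N%:R| * `|c.1%:~R - c'.1%:~R|)).
    by rewrite ler_wpM2r.
  rewrite normrM mulrAC -normrM [ `|N%:R| ]ger0_norm ?ler0n //.
  by rewrite ler_wpM2r ?ler0n.
have hnN : (n < N)%N by rewrite /n; move: ik jk; clear; lia.
move: hnN hnD hD N0; clear; nia.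
Qed.

Lemma common_cells_le (R : archiRealFieldType) (k i j : nat)
    (p q m b m' b' : R) (F : seq (int * int)) :
  q - p <= 1 -> (i < 2 ^ k)%N -> (j < 2 ^ k)%N -> uniq F ->
  i%:R <= m * 2 ^+ k <= i.+1%:R -> j%:R <= m' * 2 ^+ k <= j.+1%:R ->
  (count (fun c => meets_cell k p q m b c && meets_cell k p q m' b' c) F)%:R
    <= 882 * 2 ^+ k / ((i - j) + (j - i)).+1%:R :> R.
Proof.
move=> pq ik jk uF mi mj; rewrite ler_pdivlMr ?ltr0n //.
have -> : 882 * 2 ^+ k = (882 * 2 ^ k)%N%:R :> R by rewrite natrM natrX.
rewrite -natrM ler_nat -size_filter.
set P := fun _ => _; set s := seq.filter P F.
have [->//|[c0 c0s]] : s = [::] \/ exists c0, c0 \in s.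
  by case: s => [|c s]; [left|right; exists c; rewrite mem_head].
set n := (i - j + (j - i))%N.
(* All common cells lie fewer than [T] columns away from the fixed one [c0]; 882 is 18 * 49. *)
pose T := ((49 * 2 ^ k) %/ n.+1)%N.
have hs : (size s <= 18 * T)%N.
  apply: (@size_graph_nbhd_le R _ _ c0.1 (fun u => m * u%:~R + b * 2 ^+ k)).
    exact: filter_uniq.
  move: c0s; rewrite mem_filter => /andP[/andP[h1 h2] _].
  move=> c; rewrite mem_filter => /andP[/andP[h3 h4] _].
  split; last by case/and3P: h3.
  rewrite /T leq_divRL // mulnC.
  exact: (common_cells_dist pq ik jk mi mj h3 h4 h1 h2).
have : (T * n.+1 <= 49 * 2 ^ k)%N by exact: leq_divM.
move: hs; clear; nia.
Qed.

(** Double counting: there are at least |J| L incidences between lines and cells, and by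
    Cauchy-Schwarz their square is at most |F| times the number of common cells summed over all
    pairs of lines. For one fixed line that sum is harmonic, whence the factor k + 1. *)
Lemma cordoba_le (R : archiRealFieldType) : exists2 K : R, 0 < K &
  forall (k : nat) (J : {set 'I_(2 ^ k)}) (m b : 'I_(2 ^ k) -> R)
    (F : seq (int * int)) (p q L : R),
  q - p <= 1 -> uniq F -> 0 <= L ->
  (forall j, j \in J -> j%:R <= m j * 2 ^+ k <= j.+1%:R) ->
  (forall j, j \in J -> L <= (count (meets_cell k p q (m j) (b j)) F)%:R) ->
  #|J|%:R * L ^+ 2 <= K * (size F)%:R * 2 ^+ k * k.+1%:R.
Proof.
exists (882 * 2) => [|k J m b F p q L pq uF L0 mJ LJ]; first by rewrite mulr_gt0 ?ltr0n.
pose a j c : R := (meets_cell k p q (m j) (b j) c)%:R.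
have countE j : (count (meets_cell k p q (m j) (b j)) F)%:R = \sum_(c <- F) a j c.
  rewrite -sum1_count natr_sum big_mkcond.
  by apply: eq_bigr => c _; rewrite /a; case: ifP.
have common j j' : j \in J -> j' \in J ->
    \sum_(c <- F) a j c * a j' c
      <= 882 * 2 ^+ k * ((j - j') + (j' - j)).+1%:R^-1.
  move=> jJ j'J; apply: le_trans (common_cells_le (b (j)) (b j') pq (ltn_ord j)
    (ltn_ord j') uF (mJ _ jJ) (mJ _ j'J)).
  rewrite -sum1_count natr_sum [leRHS]big_mkcond /= le_eqVlt; apply/orP; left.
  apply/eqP; apply: eq_bigr => c _; rewrite /a -natrM mulnb.
  by case: (_ && _).
have rowsum (j : 'I_(2 ^ k)) : j \in J -> \sum_(j' in J) \sum_(c <- F) a j c * a j' c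
    <= 882 * 2 * 2 ^+ k * k.+1%:R.
  move=> jJ.
  apply: (@le_trans _ _ (\sum_(j' in J) (882 * 2 ^+ k * ((j' - j) + (j - j')).+1%:R^-1))).
    by apply: ler_sum => j' j'J; rewrite [(j' - j + _)%N]addnC common.
  rewrite -mulr_sumr.
  have -> : 882 * 2 * 2 ^+ k * k.+1%:R = 882 * 2 ^+ k * (2 * k.+1%:R) :> R by ring.
  rewrite ler_wpM2l ?mulr_ge0 ?exprn_ge0 ?ler0n //.
  have := sum_inv_dist_le R (ltn_ord j); rewrite big_mkord => h.
  apply: (@le_trans _ _ (\sum_(i < 2 ^ k) (i - j + (j - i)).+1%:R^-1)).
    rewrite [leLHS]big_mkcond; apply: ler_sum => i _.
    by case: ifP => // _; rewrite invr_ge0 ler0n.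
  by apply: le_trans h _; rewrite ler_wpM2l // sum_inv_le.
have [J0|J0] := posnP #|J|.
  by rewrite J0 mul0r !mulr_ge0 ?ler0n ?exprn_ge0.
have Jpos : 0 < #|J|%:R :> R by rewrite ltr0n.
pose S := \sum_(c <- F) \sum_(j in J) a j c.
have SJ : #|J|%:R * L <= S.
  rewrite /S exchange_big /= mulr_natl -sumr_const.
  by apply: ler_sum => j jJ; rewrite -countE LJ.
have S2 : S ^+ 2 <= (size F)%:R * (#|J|%:R * (882 * 2 * 2 ^+ k * k.+1%:R)).
  apply: le_trans (sqr_sum_le _ _) _; rewrite ler_wpM2l ?ler0n //.
  rewrite mulr_natl -sumr_const.
  have -> : \sum_(c <- F) (\sum_(j in J) a j c) ^+ 2 =
      \sum_(j in J) \sum_(j' in J) \sum_(c <- F) a j c * a j' c.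
    under [RHS]eq_bigr do rewrite exchange_big /=.
    rewrite [RHS]exchange_big /=; apply: eq_bigr => c _.
    rewrite expr2 mulr_suml; apply: eq_bigr => j _.
    by rewrite mulr_sumr.
  by apply: ler_sum => j jJ; exact: rowsum.
have : (#|J|%:R * L) ^+ 2 <= S ^+ 2.
  by rewrite ler_sqr ?nnegrE ?mulr_ge0 ?ler0n // (le_trans _ SJ) ?mulr_ge0 ?ler0n.
move=> /le_trans/(_ S2) h; rewrite -(ler_pM2l Jpos).
by apply: le_trans (le_trans h _); rewrite le_eqVlt; apply/orP; left; apply/eqP; ring.
Qed.

(** * Lebesgue measure of unions of intervals *)

Lemma measure_bigsetU_itv_le (R : realType) (s : seq R) (w : R) : 0 <= w ->
  let B := \big[setU/set0]_(a <- s) `[a, a + w]%classic in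
  measurable B /\ (lebesgue_measure B <= ((size s)%:R * w)%:E)%E.
Proof.
move=> w0 /=; elim: s => [|a s [IHm IHs]].
  by rewrite !big_nil mul0r measure0.
rewrite !big_cons; split; first exact: measurableU.
have Hw : (lebesgue_measure `[a, (a + w)%R]%classic <= w%:E)%E.
  rewrite lebesgue_measure_itv /=; case: ifP => _; last by rewrite lee_fin.
  by rewrite -EFinB lee_fin; lra.
apply: (le_trans (measureU2 (@lebesgue_measure R) (measurable_itv _) IHm)).
have -> : (size (a :: s))%:R * w = w + (size s)%:R * w by rewrite /= -natr1; ring.
rewrite EFinD; exact: leeD.
Qed.

Lemma measure_bigcup_geometric_le (R : realType) (s : nat -> seq R) (w : nat -> R)
    (t z : R) :
  0 <= t -> 0 < z < 1 -> (forall k, 0 <= w k) ->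
  (forall k, (size (s k))%:R * w k <= t * z ^+ k) ->
  let B := \bigcup_k \big[setU/set0]_(a <- s k) `[a, a + w k]%classic in
  measurable B /\ (lebesgue_measure B <= (t / (1 - z))%:E)%E.
Proof.
move=> t0 /andP[z0 z1] w0 sw B.
have mB : measurable B.
  by apply: bigcupT_measurable => k; exact: (measure_bigsetU_itv_le (s k) (w0 k)).1.
split => //.
have mF k := (measure_bigsetU_itv_le (s k) (w0 k)).1.
apply: (le_trans (measure_sigma_subadditive (@lebesgue_measure R) mF mB _)) => //.
apply: lime_le; first exact: is_cvg_nneseries.
apply: nearW => n.
apply: (@le_trans _ _ (\sum_(0 <= k < n) (t * z ^+ k)%:E)%E).
  apply: lee_sum => k _.
  by apply: le_trans (measure_bigsetU_itv_le (s k) (w0 k)).2 _; rewrite lee_fin.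
rewrite sumEFin lee_fin.
have -> : \sum_(0 <= k < n) t * z ^+ k = t * (1 - z ^+ n) / (1 - z).
  have := @geometric_seriesE R t z; rewrite lt_eqF // => /(_ isT)/(congr1 (fun f => f n)).
  by rewrite /series /=.
by rewrite ler_pM2r ?invr_gt0 ?subr_gt0 // ler_piMr // gerBl exprn_ge0 // ltW.
Qed.

(** [A] may fail to be measurable; the intersection of covers of measure at most 1/(n+1) is a
    measurable null superset. *)
Lemma negligible_small_cover (R : realType) (A : set R) :
  (forall e : R, 0 < e -> exists B : set R,
    [/\ measurable B, (lebesgue_measure B <= e%:E)%E & A `<=` B]) ->
  (@lebesgue_measure R).-negligible A.
Proof.
move=> cover.
have /choice[B hB] : forall n : nat, exists B : set R,
    [/\ measurable B, (lebesgue_measure B <= n.+1%:R^-1%:E)%E & A `<=` B].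
  by move=> n; apply: cover; rewrite invr_gt0 ltr0n.
exists (\bigcap_n B n); split.
- by apply: bigcapT_measurable => n; have [] := hB n.
- apply/eqP; rewrite eq_le measure_ge0 andbT; apply/lee_addgt0Pr => e e0.
  rewrite add0e; have [n ne] := ltr_add_invr (e0 : 0 < e).
  have [mB Bn _] := hB n.
  apply: (@le_trans _ _ (lebesgue_measure (B n))).
    apply: le_measure; rewrite ?inE //; last exact: bigcap_inf.
    by apply: bigcapT_measurable => i; have [] := hB i.
  apply: le_trans Bn _; rewrite lee_fin ltW //.
  by rewrite add0r in ne.
- by move=> x Ax n _; have [_ _] := hB n; exact.
Qed.

(** * Dyadic covers of a set of Hausdorff measure zero *)

Lemma enorm_le_diam (R : realType) (n : nat) (U : set 'rV[R]_n) (x y : 'rV[R]_n) :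
  U x -> U y -> ((enorm (x - y))%:E <= diam U)%E.
Proof. by move=> Ux Uy; apply: ereal_sup_ubound; right; exists x => //; exists y. Qed.

Lemma diam_ge0 (R : realType) (n : nat) (U : set 'rV[R]_n) : (0 <= diam U)%E.
Proof. by apply: ereal_sup_ubound; left. Qed.

Lemma diam_pow_ge0 (R : realType) (n : nat) (s : R) (U : set 'rV[R]_n) :
  (0 <= diam_pow s U)%E.
Proof. by rewrite /diam_pow; case: ifP => // _; exact: poweR_ge0. Qed.

Lemma dyadic_scale (R : realType) (k0 : nat) (r : R) : 0 < r -> r <= 2 ^- k0 ->
  exists k, [/\ (k0 <= k)%N, r <= 2 ^- k & 2 ^- k.+1 < r].
Proof.
move=> r0 rk0.
have ex : exists k, 2 ^- k < r.
  exists (Num.Def.archi_bound r^-1).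
  by rewrite invf_plt ?posrE ?exprn_gt0 // upper_nthrootP.
(* The least k with 2^-k < r is positive because r <= 1; its predecessor is the scale. *)
case: (ex_minnP ex) => [[|k]] kr kmin.
  have : r <= 1.
    by apply: le_trans rk0 _; rewrite invf_le1 ?exprn_gt0 // exprn_ege1 ?ler1n.
  by move: kr; rewrite expr0 invr1; lra.
exists k; split => //; last by rewrite leNgt; apply/negP => /kmin; rewrite ltnn.
rewrite -ltnS ltnNge; apply/negP => h; have := lt_le_trans kr rk0.
by rewrite ltf_pV2 ?posrE ?exprn_gt0 // ltr_eXn2l ?ltr1n // ltnNge h.
Qed.

Lemma null_cover (R : realType) (n : nat) (s d : R) (K : set 'rV[R]_n) :
  0 < d -> hausdorff_measure s K = 0%E ->
  exists U : (set 'rV[R]_n)^nat, [/\ K `<=` \bigcup_i U i,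
    (forall i, diam (U i) <= d%:E)%E &
    (\sum_(0 <= i <oo) diam_pow s (U i) <= 1)%E].
Proof.
move=> d0 K0.
have : (hausdorff_content s d K < 1)%E.
  apply: (@le_lt_trans _ _ 0%E); last exact: lte01.
  by rewrite -K0; apply: ereal_sup_ubound; exists d.
by move=> /ereal_inf_lt[_ [U [KU dU] <-]] U1; exists U; split => //; exact: ltW.
Qed.

Lemma powR_half_expn (R : realType) (s : R) (k : nat) :
  (2 ^- k) `^ s = (2 `^ s) ^- k.
Proof.
by rewrite -powR_invn // -powRrM mulrC powRrM powR_invn // powR_ge0.
Qed.

(** With g = 2^s, a set of scale k and positive diameter contributes at least g^-(k+1) to a sum
    bounded by 1, so there are at most g^(k+1) <= 4 g^k of them. At most one set of diameter 0 is
    added, which gives the 5. *)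
Lemma dyadic_cover (R : realType) (n : nat) (s : R) (K : set 'rV[R]_n) (k0 : nat) :
  0 <= s -> s <= 2 -> hausdorff_measure s K = 0%E ->
  exists (U : (set 'rV[R]_n)^nat) (scale : nat -> nat),
  [/\ K `<=` \bigcup_i U i,
      (forall i, (k0 <= scale i)%N),
      (forall i x y, U i x -> U i y -> enorm (x - y) <= 2 ^- scale i) &
      forall k (F : {fset nat}),
        (forall i, i \in F -> scale i = k /\ U i !=set0) ->
        (#|` F|%fset)%:R <= 5 * (2 `^ s) ^+ k].
Proof.
move=> s0 s2 K0.
have d0 : 0 < 2 ^- k0 :> R by rewrite invr_gt0 exprn_gt0.
have [U [KU dU U1]] := null_cover d0 K0.
have rE i : exists r : R, [/\ diam (U i) = r%:E, 0 <= r & r <= 2 ^- k0].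
  have := dU i; have := diam_ge0 (U i); case: (diam (U i)) => [r| |] //.
  by rewrite !lee_fin => r0 r1; exists r.
have /choice[r hr] := rE.
have /choice[scale hs] : forall i, exists k, [/\ (k0 <= k)%N, r i <= 2 ^- k &
    if r i == 0 then k = (k0 + i)%N else 2 ^- k.+1 < r i].
  (* Sets of diameter 0 get distinct scales, hence at most one per scale. *)
  move=> i; have [_ r0 r1] := hr i; case: eqP => [->|/eqP ri0].
    by exists (k0 + i)%N; split; rewrite ?leq_addr // invr_ge0 exprn_ge0.
  by apply: dyadic_scale => //; rewrite lt_neqAle eq_sym ri0.
exists U, scale; split => //.
- by move=> i; have [] := hs i.
- move=> i x y Ux Uy; have := enorm_le_diam Ux Uy.
  by have [-> _ _] := hr i; rewrite lee_fin => /le_trans; apply; have [] := hs i.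
move=> k F hF.
have sg1 : 1 <= 2 `^ s by have := ler_powR (ler1n R 2) s0; rewrite powRr0; apply.
have sg4 : 2 `^ s <= 4.
  apply: (@le_trans _ _ (2 `^ 2%:R)); first by rewrite ler_powR ?ler1n.
  by rewrite powR_mulrn // expr2 -natrM.
set g := 2 `^ s in sg1 sg4 *.
pose F0 := [fset i in F | r i == 0]%fset; pose F1 := [fset i in F | r i != 0]%fset.
have FE : (#|` F| = #|` F0| + #|` F1|)%N%fset.
  rewrite -(cardfsUI F0 F1).
  have -> : (F0 `|` F1)%fset = F.
    by apply/fsetP => i; rewrite !inE; case: (r i == 0); rewrite /= ?andbT ?andbF ?orbF.
  have -> : (F0 `&` F1)%fset = fset0.
    by apply/fsetP => i; rewrite !inE; case: (r i == 0); rewrite /= ?andbT ?andbF.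
  by rewrite cardfs0 addn0.
have hF0 : (#|` F0| <= 1)%N%fset.
  have sub : (F0 `<=` [fset (k - k0)%N])%fset.
    apply/fsubsetP => i; rewrite !inE => /andP[iF ri].
    have [_ _] := hs i; rewrite ri; have [-> _] := hF _ iF; move=> ->.
    by rewrite addKn.
  by have := fsubset_leq_card sub; rewrite cardfs1.
have hF1 : (#|` F1|%fset)%:R * g ^- k.+1 <= 1.
  rewrite -lee_fin.
  have [N hN] : exists N, forall i, i \in F1 -> (i < N)%N.
    exists (\max_(i <- F1) i)%N.+1 => i iF1.
    by rewrite ltnS (@leq_bigmax_seq _ _ xpredT id).
  have F1N : {subset F1 <= [fset i in iota 0 N]%fset}.
    by move=> i /hN iN; rewrite !inE mem_iota.
  apply: le_trans U1.
  apply: le_trans (nneseries_lim_ge N _); last by move=> *; exact: diam_pow_ge0.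
  apply: (@le_trans _ _ (\sum_(i <- F1) diam_pow s (U i))%E).
    apply: (@le_trans _ _ (\sum_(i <- F1) (g ^- k.+1)%:E)%E).
      by rewrite sumEFin lee_fin big_const_seq count_predT iter_addr_0 mulr_natl.
    rewrite [leLHS]big_seq_cond [leRHS]big_seq_cond; apply: lee_sum => i.
    rewrite !inE !andbT => /andP[iF ri].
    have [<- Ui] := hF _ iF; have [_ _] := hs i; rewrite (negPf ri) => h.
    rewrite /diam_pow ifF; last by apply/negbTE/set0P.
    have [-> ri0 _] := hr i; rewrite poweR_EFin lee_fin -powR_half_expn.
    by rewrite ge0_ler_powR ?nnegrE ?invr_ge0 ?exprn_ge0 // ltW.
  have -> : (\sum_(0 <= i < N) diam_pow s (U i))%E =
      (\sum_(i <- [fset i in iota 0 N]%fset) diam_pow s (U i))%E.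
    rewrite /index_iota subn0; apply: perm_big.
    by apply: uniq_perm; rewrite ?iota_uniq ?fset_uniq // => i; rewrite !inE.
  by apply: lee_sum_nneg_subfset => // i _ _; exact: diam_pow_ge0.
have gk : 0 < g ^+ k by rewrite exprn_gt0 // (lt_le_trans ltr01).
have hF1' : (#|` F1|%fset)%:R <= g ^+ k.+1.
  by move: hF1; rewrite ler_pdivrMr ?mul1r // exprn_gt0 // (lt_le_trans ltr01).
have g1k : 1 <= g ^+ k by exact: exprn_ege1.
rewrite FE natrD.
have : (#|` F0|%fset)%:R <= 1 :> R by rewrite -[leRHS]/(1%:R) ler_nat.
move: hF1'; rewrite exprS; nra.
Qed.

(** * Slopes of segments covered by dyadic cells *)

(** The tolerance 2, in units of the cell side, is 1 for the diameter of a covering set plus 1 for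
    rounding one of its points to a cell corner. *)
Definition covers_segment (R : realType) (F : nat -> seq (int * int))
    (p q m b : R) : Prop :=
  forall x, p <= x <= q -> exists k c, [/\ c \in F k,
    `|x * 2 ^+ k - c.1%:~R| <= 2 & `|(m * x + b) * 2 ^+ k - c.2%:~R| <= 2].

(** Otherwise the cells met at scale k have shadows of length 4 * 2^-k on the x-axis whose total
    length, summed over k, is at most 4 c0 / (1 - z) = (q - p) / 2, too little to cover [p, q]. *)
Lemma exists_rich_scale (R : realType) (F : nat -> seq (int * int))
    (p q m b z : R) :
  p < q -> 0 <= m <= 1 -> 0 < z < 1 -> covers_segment F p q m b ->
  exists k, (1 - z) * (q - p) / 8 * z ^+ k * 2 ^+ k
    <= (count (meets_cell k p q m b) (F k))%:R.
Proof.
move=> pq /andP[m0 m1] z01 Fpq; apply: contrapT => /forallNP noscale.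
have /andP[z0 z1] := z01.
set c0 := (1 - z) * (q - p) / 8 in noscale.
have c00 : 0 <= c0 by rewrite /c0 divr_ge0 // mulr_ge0 // subr_ge0 ltW.
pose s k := [seq (c.1%:~R - 2) * 2 ^- k | c <- F k & meets_cell k p q m b c] : seq R.
pose w k : R := 4 * 2 ^- k.
have w0 k : 0 <= w k by rewrite mulr_ge0 // invr_ge0 exprn_ge0.
have sw k : (size (s k))%:R * w k <= 4 * c0 * z ^+ k.
  rewrite size_map size_filter /w mulrA ler_pdivrMr ?exprn_gt0 //.
  have := noscale k => /negP; rewrite -ltNge; lra.
have t0 : 0 <= 4 * c0 by rewrite mulr_ge0.
have [mB Bt] := measure_bigcup_geometric_le t0 z01 w0 sw.
set B := (X in measurable X) in mB Bt.
have pqB : `[p, q]%classic `<=` B.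
  move=> x; rewrite /= in_itv /= => xpq.
  have [k [c [cF h1 h2]]] := Fpq x xpq.
  exists k => //; rewrite -bigcup_seq.
  have N0 : 0 < 2 ^+ k :> R by rewrite exprn_gt0.
  move: h1 h2; set N := 2 ^+ k in N0 *; rewrite !ler_norml => /andP[h1 h2] /andP[h3 h4].
  have /andP[px xq] := xpq.
  have mc : meets_cell k p q m b c.
    rewrite /meets_cell -/N ler_norml.
    have a1 : p * N <= x * N by rewrite ler_pM2r.
    have a2 : x * N <= q * N by rewrite ler_pM2r.
    apply/and3P; split; [|lra|lra].
    have a3 : `|m * (x * N - c.1%:~R)| <= 2.
      rewrite normrM ger0_norm // -[leRHS]mul1r ler_pM ?normr_ge0 // ler_norml; lra.
    move: a3; rewrite ler_norml => /andP[a3 a4]; apply/andP; split; lra.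
  exists ((c.1%:~R - 2) * 2 ^- k).
    by apply/mapP; exists c => //; rewrite mem_filter mc.
  rewrite /= in_itv /= /w -/N -mulrDl ler_pdivrMr // ler_pdivlMr //.
  by apply/andP; split; lra.
have : (lebesgue_measure `[p, q]%classic <= (4 * c0 / (1 - z))%:E)%E.
  apply: le_trans Bt; apply: le_measure; rewrite ?inE //; exact: measurable_itv.
rewrite lebesgue_measure_itv /= lte_fin pq -EFinB lee_fin /c0.
rewrite ler_pdivlMr ?subr_gt0 //.
have : 0 < (q - p) * (1 - z) by rewrite mulr_gt0 ?subr_gt0.
lra.
Qed.

(** The quotient (1 - z^(k+1)) / (1 - z) is a sum of k + 1 powers of z, each at least z^k. One
    factor z^k thus absorbs a factor k + 1. *)
Lemma succ_mul_expr_le (R : realFieldType) (z : R) (k : nat) : 0 < z < 1 ->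
  k.+1%:R * z ^+ k * (1 - z) <= 1.
Proof.
move=> /andP[z0 z1]; suff : k.+1%:R * z ^+ k * (1 - z) <= 1 - z ^+ k.+1.
  by move=> /le_trans; apply; rewrite gerBl exprn_ge0 // ltW.
elim: k => [|k IHk]; first by rewrite expr0 expr1; lra.
rewrite -[k.+2%:R]natr1 ![_ ^+ k.+2]exprS.
have zk : 0 <= z ^+ k.+1 by rewrite exprn_ge0 // ltW.
have zk1 : z ^+ k.+1 <= 1 by rewrite exprn_ile1 // ltW.
move: IHk zk zk1; rewrite exprS; set y := z ^+ k; set n := k.+1%:R => *; nra.
Qed.

(** Every slope has a rich scale k, and [cordoba_le] bounds the number of dyadic intervals of length
    2^-k containing slopes rich at that scale. The union of these intervals over k >= k0 is the
    cover; [C] does not depend on [F], so a large [k0] makes it small. *)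
Lemma slopes_small_cover (R : realType) (p q z : R) :
  p < q -> q - p <= 1 -> 0 < z < 1 ->
  exists2 C : R, 0 <= C &
  forall (F : nat -> seq (int * int)) (M : set R) (g : R) (k0 : nat),
    0 <= g -> g <= 4 * z ^+ 4 ->
    (forall k, uniq (F k)) -> (forall k, (size (F k))%:R <= 5 * g ^+ k) ->
    (forall k, (k < k0)%N -> F k = [::]) ->
    (forall m, M m -> 0 <= m < 1 /\ exists b, covers_segment F p q m b) ->
  exists B : set R, [/\ measurable B,
    (lebesgue_measure B <= (C * z ^+ k0)%:E)%E & M `<=` B].
Proof.
move=> pq pq1 z01; have /andP[z0 z1] := z01.
have z1' : 0 < 1 - z by rewrite subr_gt0.
have [K K0 cordoba] := cordoba_le R.
set c0 := (1 - z) * (q - p) / 8; pose C := K * 5 / (1 - z) / c0 ^+ 2.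
have c00 : 0 < c0 by rewrite /c0 divr_gt0 // mulr_gt0 // subr_gt0.
have C0 : 0 <= C by rewrite /C !mulr_ge0 ?invr_ge0 ?exprn_ge0 // ltW.
exists (C / (1 - z)); first by rewrite divr_ge0 // ltW.
move=> F M g k0 g0 gz uF sF F0 hM.
pose P k (j : 'I_(2 ^ k)) (mb : R * R) := [/\ M mb.1,
  j%:R <= mb.1 * 2 ^+ k <= j.+1%:R &
  c0 * z ^+ k * 2 ^+ k <= (count (meets_cell k p q mb.1 mb.2) (F k))%:R].
pose J k : {set 'I_(2 ^ k)} := [set j | `[< exists mb, P k j mb >]]%SET.
(* Of the four factors z^k in the bound on g^k, two pay for the square in
   cordoba_le, one for the logarithmic factor k + 1, and the last one makes the
   bound summable in k. *)
have cardJ k : #|J k|%:R * 2 ^- k <= C * z ^+ k.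
  clearbody c0.
  (* One slope and intercept represent each index in [J k]; (0, 0) is a default elsewhere. *)
  have /choice[mb hmb] : forall j : 'I_(2 ^ k), exists mb, j \in J k -> P k j mb.
    move=> j; have [jJ|jJ] := boolP (j \in J k); last by exists (0, 0).
    by move: jJ; rewrite inE => /asboolP[mb ?]; exists mb.
  have zk0 : 0 < z ^+ k by rewrite exprn_gt0.
  have tk0 : 0 < 2 ^+ k :> R by rewrite exprn_gt0.
  have L0 : 0 <= c0 * z ^+ k * 2 ^+ k.
    by apply: ltW; apply: mulr_gt0 => //; apply: mulr_gt0.
  have := cordoba k (J k) (fun j => (mb j).1) (fun j => (mb j).2) (F k)
    p q _ pq1 (uF k) L0.
  move=> /(_ (fun j jJ => let: And3 _ h _ := hmb j jJ in h)).
  move=> /(_ (fun j jJ => let: And3 _ _ h := hmb j jJ in h)) h.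
  have gk : g ^+ k <= (2 ^+ k * 2 ^+ k) * (z ^+ k) ^+ 4.
    rewrite -exprMn -natrM -exprM mulnC exprM -exprMn.
    by rewrite lerXn2r ?nnegrE // mulr_ge0 ?exprn_ge0 // ltW.
  have h1 := succ_mul_expr_le k z01.
  have := sF k; rewrite (ler_pdivrMr _ _ tk0); move: h gk h1 zk0 tk0.
  set x := #|_|%:R; set y := z ^+ k; set N := 2 ^+ k; set f := (size _)%:R.
  set r := k.+1%:R => h gk h1 y0 N0 fg.
  have r0 : 0 < r by rewrite /r ltr0n.
  rewrite -(ler_pM2r (_ : 0 < c0 ^+ 2 * y ^+ 2 * N ^+ 2)); last first.
    by rewrite !mulr_gt0 ?exprn_gt0.
  have -> : x * (c0 ^+ 2 * y ^+ 2 * N ^+ 2) = x * (c0 * y * N) ^+ 2 by ring.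
  apply: le_trans h _.
  have -> : C * y * N * (c0 ^+ 2 * y ^+ 2 * N ^+ 2) =
      K * 5 * y ^+ 3 * N ^+ 3 * (1 / (1 - z)).
    by rewrite /C; field; rewrite !lt0r_neq0.
  apply: (@le_trans _ _ (K * (5 * (N * N * y ^+ 4)) * N * r)).
    rewrite (ler_pM2r r0) (ler_pM2r N0) (ler_pM2l K0); apply: le_trans fg _.
    by rewrite ler_pM2l.
  have -> : K * (5 * (N * N * y ^+ 4)) * N * r =
      K * 5 * y ^+ 3 * N ^+ 3 * (r * y) by ring.
  by rewrite ler_pM2l ?ler_pdivlMr // !mulr_gt0 ?exprn_gt0.
pose s k : seq R :=
  [seq j%:R * 2 ^- (k0 + k) | j : 'I_(2 ^ (k0 + k)) <- enum (J (k0 + k)%N)].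
pose w k : R := 2 ^- (k0 + k).
have w0 k : 0 <= w k by rewrite invr_ge0 exprn_ge0.
have sw k : (size (s k))%:R * w k <= C * z ^+ k0 * z ^+ k.
  by rewrite size_map -cardE -mulrA -exprD cardJ.
have t0 : 0 <= C * z ^+ k0 by rewrite mulr_ge0 // exprn_ge0 // ltW.
have [mB Bt] := measure_bigcup_geometric_le t0 z01 w0 sw.
set B := (X in measurable X) in mB Bt; exists B; split => //; first by rewrite mulrAC.
move=> m Mm; have [/andP[m0 m1] [b mb]] := hM m Mm.
have m01 : 0 <= m <= 1 by rewrite m0 ltW.
have [k hk] := exists_rich_scale pq m01 z01 mb.
(* Below [k0] there are no cells, while a rich scale has a positive count. *)
have k0k : (k0 <= k)%N.
  rewrite leqNgt; apply/negP => /F0 Fk; move: hk; rewrite Fk /= leNgt => /negP; apply.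
  by apply: mulr_gt0; rewrite ?exprn_gt0 // mulr_gt0 ?exprn_gt0.
have N0 : 0 < 2 ^+ k :> R by rewrite exprn_gt0.
have mk0 : 0 <= m * 2 ^+ k by rewrite mulr_ge0 // ltW.
have /andP[j1 j2] := truncn_itv mk0.
have jk : (Num.truncn (m * 2 ^+ k) < 2 ^ k)%N.
  rewrite -(@ltr_nat R); apply: le_lt_trans j1 _.
  by rewrite natrX -[ltRHS]mul1r ltr_pM2r.
exists (k - k0)%N => //; rewrite -bigcup_seq.
have jJ : Ordinal jk \in J k.
  by rewrite inE; apply/asboolP; exists (m, b); split => //=; rewrite j1 ltW.
exists ((Num.truncn (m * 2 ^+ k))%:R * 2 ^- k).
  rewrite /= /s subnKC //; apply/mapP; exists (Ordinal jk) => //.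
  by rewrite mem_enum.
rewrite /= in_itv /= /w subnKC //.
have -> (a c : R) : a * c + c = (a + 1) * c by ring.
by rewrite ler_pdivrMr // ler_pdivlMr // natr1 j1 ltW.
Qed.

(** * Null sets of slopes and the dimension bound *)

(** [f1] and [f2] are the coordinates of a projection to the plane. Points of the segment are lifted
    to [K], so that covers of [K] apply directly. *)
Definition segment_slopes (R : realType) (T : Type) (K : set T) (f1 f2 : T -> R)
    (p q : R) : set R :=
  [set m | 0 <= m < 1 /\ exists b, forall x, p <= x <= q ->
    exists X, [/\ K X, f1 X = x & f2 X = m * x + b]].

Lemma finite_bounded_card (T : choiceType) (A : set T) (N : nat) :
  (forall F : {fset T}, {subset F <= A} -> (#|` F|%fset <= N)%N) -> finite_set A.
Proof.
move=> hA; apply: contrapT => /(infinite_set_fset N.+1)[F FA NF].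
suff : (#|` F|%fset <= N)%N by rewrite leqNgt NF.
by apply: hA => x xF; rewrite inE; exact: FA.
Qed.

Lemma dist_floor_le2 (R : archiRealFieldType) (x y : R) (k : nat) :
  `|x - y| <= 2 ^- k -> `|x * 2 ^+ k - (Num.floor (y * 2 ^+ k))%:~R| <= 2.
Proof.
have N0 : 0 < 2 ^+ k :> R by rewrite exprn_gt0.
rewrite -div1r ler_pdivlMr // -[X in _ * X](ger0_norm (ltW N0)) -normrM mulrBl.
have /andP[] := floor_itv (y * 2 ^+ k); rewrite rmorphD /=.
rewrite !ler_norml => h1 h2 /andP[h3 h4]; apply/andP; split; lra.
Qed.

(** Since s < 2, the growth rate 2^s is below 4 and leaves room for the factor z^4. The Lipschitz
    bounds turn a dyadic cover of [K] into planar cells covering every segment. *)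
Lemma negligible_segment_slopes (R : realType) (n : nat) (K : set 'rV[R]_n)
    (f1 f2 : 'rV[R]_n -> R) (s p q : R) :
  (forall x y, `|f1 x - f1 y| <= enorm (x - y)) ->
  (forall x y, `|f2 x - f2 y| <= enorm (x - y)) ->
  0 <= s -> s < 2 -> hausdorff_measure s K = 0%E ->
  p < q -> q - p <= 1 ->
  (@lebesgue_measure R).-negligible (segment_slopes K f1 f2 p q).
Proof.
move=> lip1 lip2 s0 s2 K0 pq pq1.
set g := 2 `^ s; have g0 : 0 <= g by exact: powR_ge0.
have g4 : g < 4.
  have -> : 4 = 2 `^ 2%:R :> R by rewrite powR_mulrn // expr2 -natrM.
  have -> : 2 `^ 2%:R = g * 2 `^ (2 - s) :> R.
    by rewrite -powRD ?pnatr_eq0 ?implybT // addrC subrK.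
  rewrite ltr_pMr ?powR_gt0 //.
  have s20 : 0 < 2 - s by rewrite subr_gt0.
  have := @gt0_ltr_powR R (2 - s) s20 1 2; rewrite powR1; apply.
  - by rewrite nnegrE.
  - by rewrite nnegrE.
  - by rewrite ltr1n.
have [z [z0 z1 gz]] : exists z, [/\ 0 < z, z < 1 & g <= 4 * z ^+ 4].
  have [e [e0 e1 ->]] : exists e, [/\ 0 < e, e <= 1 & g = 4 * (1 - e)].
    by exists (1 - g / 4); split; [lra|lra|field].
  (* Bernoulli: (1 - e/4)^4 >= 1 - e. *)
  exists (1 - e / 4); split; [lra|lra|]; rewrite ler_pM2l //.
  have e2 : 0 < e ^+ 2 by exact: exprn_gt0.
  have e4 : 0 <= e ^+ 4 by exact/exprn_ge0/ltW.
  have e3 : e ^+ 3 <= e ^+ 2 by rewrite exprSr ger_pMr.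
  have -> : (1 - e / 4) ^+ 4 =
      1 - e + (96 * e ^+ 2 - 16 * e ^+ 3 + e ^+ 4) / 256 by field.
  by lra.
have z01 : 0 < z < 1 by rewrite z0.
have [C C0 small] := slopes_small_cover pq pq1 z01.
apply: negligible_small_cover => e e0.
have [k0 hk0] : exists k0, C * z ^+ k0 <= e.
  have z1' : 0 < 1 - z by rewrite subr_gt0.
  (* As k exceeds C / ((1 - z) e), C z^k <= k z^k (1 - z) e <= e. *)
  pose k := Num.Def.archi_bound (C / ((1 - z) * e)); exists k.
  have Ce0 : 0 <= C / ((1 - z) * e) by rewrite divr_ge0 // mulr_ge0 // ltW.
  have := archi_boundP Ce0; rewrite -/k ltr_pdivrMr ?mulr_gt0 // => h.
  have h1 := succ_mul_expr_le k z01.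
  have zk : 0 <= z ^+ k by rewrite exprn_ge0 // ltW.
  have h2 : k%:R * z ^+ k * (1 - z) <= 1.
    apply: le_trans h1; rewrite ler_pM2r // ler_wpM2r // ler_nat //.
  apply: (@le_trans _ _ (k%:R * ((1 - z) * e) * z ^+ k)).
    by rewrite ler_wpM2r // ltW.
  have -> : k%:R * ((1 - z) * e) * z ^+ k = (k%:R * z ^+ k * (1 - z)) * e by ring.
  by rewrite ger_pMl.
have [U [scale [KU k0U dU cardU]]] := dyadic_cover k0 s0 (ltW s2) K0.
pose A k : set nat := [set i | scale i = k /\ U i !=set0].
have cardA k (F : {fset nat}) : {subset F <= A k} -> (#|` F|%fset)%:R <= 5 * g ^+ k.
  by move=> FA; apply: cardU => i /FA; rewrite inE.
have finA k : finite_set (A k).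
  apply: (@finite_bounded_card _ _ (Num.truncn (5 * g ^+ k))) => F /cardA.
  by rewrite truncn_ge_nat // mulr_ge0 // exprn_ge0.
(* A chosen point of each nonempty covering set determines the cell that stands for the set. *)
have /choice[P hP] : forall i, exists X, U i !=set0 -> U i X.
  move=> i; have [[X UX]|nU] := pselect (U i !=set0); first by exists X.
  by exists 0 => /nU.
pose cell k i := (Num.floor (f1 (P i) * 2 ^+ k), Num.floor (f2 (P i) * 2 ^+ k)).
pose F k := undup [seq cell k i | i <- fset_set (A k)].
have [||||B [mB Be MB]] := small F (segment_slopes K f1 f2 p q) g k0 g0 gz.
- by move=> k; exact: undup_uniq.
- move=> k; apply: (@le_trans _ _ (#|` fset_set (A k)|%fset)%:R).
    by rewrite ler_nat (leq_trans (size_undup _)) // size_map.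
  by apply: cardA => i; rewrite in_fset_set.
- move=> k kk0; rewrite /F (_ : A k = set0) ?fset_set0 //.
  by apply/seteqP; split => // i [ik _]; have := k0U i; rewrite ik leqNgt kk0.
- move=> m [m01 [b hb]]; split => //; exists b => x xpq.
  have [X [KX f1X f2X]] := hb x xpq.
  have [i _ UX] := KU X KX; pose k := scale i.
  have UP : U i (P i) by apply: hP; exists X.
  exists k, (cell k i); split.
  + rewrite mem_undup; apply/mapP; exists i => //.
    by rewrite in_fset_set // inE; split => //; exists X.
  + by rewrite -f1X; apply: dist_floor_le2; apply: le_trans (lip1 _ _) (dU _ _ _ UX UP).
  + by rewrite -f2X; apply: dist_floor_le2; apply: le_trans (lip2 _ _) (dU _ _ _ UX UP).
by exists B; split => //; apply: le_trans Be _; rewrite lee_fin.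
Qed.

(** A mesh finer than half of d - c leaves room to round up c and take one more step. These
    intervals form a countable family, although the segments themselves vary with the slope. *)
Lemma subinterval_div (R : realType) (c d : R) : c < d ->
  exists (a : int) (n : nat),
    c <= a%:~R / n.+1%:R /\ (a + 1)%:~R / n.+1%:R <= d.
Proof.
move=> cd; have cd2 : 0 < (d - c) / 2 by rewrite divr_gt0 // subr_gt0.
have [n] := ltr_add_invr cd2; rewrite add0r => hn.
have n0 : 0 < n.+1%:R :> R by rewrite ltr0n.
have /andP[h1 h2] := floor_itv (c * n.+1%:R).
exists (Num.floor (c * n.+1%:R) + 1), n; split.
  by rewrite ler_pdivlMr // ltW.
move: hn; rewrite ler_pdivrMr // -div1r ltr_pdivrMr // => hn.
rewrite !rmorphD /=; lra.
Qed.

Lemma dim_ge2_of_segments (R : realType) (n : nat) (K : set 'rV[R]_n)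
    (f1 f2 : 'rV[R]_n -> R) (s : R) :
  (forall x y, `|f1 x - f1 y| <= enorm (x - y)) ->
  (forall x y, `|f2 x - f2 y| <= enorm (x - y)) ->
  (forall m : R, 0 <= m < 1 -> exists b c d : R, c < d /\ forall x, c <= x <= d ->
     exists X, [/\ K X, f1 X = x & f2 X = m * x + b]) ->
  0 <= s -> hausdorff_measure s K = 0%E -> 2 <= s.
Proof.
move=> lip1 lip2 seg s0 K0; rewrite leNgt; apply/negP => s2.
(* Unpickling enumerates the pairs (a, k); other codes give the empty set. *)
pose N i : set R := if (choice.unpickle i : option (int * nat)) is Some (a, k) then
  segment_slopes K f1 f2 (a%:~R / k.+1%:R) ((a + 1)%:~R / k.+1%:R) else set0.
have N0 i : (@lebesgue_measure R).-negligible (N i).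
  rewrite /N; case: choice.unpickle => [[a k]|]; last exact: negligible_set0.
  have k0 : 0 < k.+1%:R^-1 :> R by rewrite invr_gt0 ltr0n.
  apply: (negligible_segment_slopes lip1 lip2 s0 s2 K0).
    by rewrite ltr_pM2r // ltr_int ltrDl.
  by rewrite -mulrBl -intrB addrC addKr mul1r invf_le1 ?ltr0n // ler1n.
have sub : `[0, 1[%classic `<=` \bigcup_i N i.
  move=> m; rewrite /= in_itv /= => m01.
  have [b [c [d [cd hb]]]] := seg m m01.
  have [a [k [ca ad]]] := subinterval_div cd.
  exists (choice.pickle (a, k)); first exact: Logic.I.
  rewrite /N choice.pickleK.
  split => //; exists b => x /andP[ax xa].
  by apply: hb; rewrite (le_trans ca ax) (le_trans xa ad).
have : (@lebesgue_measure R).-negligible (`[0, 1[%classic : set R).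
  have UN : (@lebesgue_measure R).-negligible (\bigcup_i N i) by apply: negligible_bigcup.
  by apply: negligibleS UN.
move=> I0; have : lebesgue_measure (`[0%R, 1%R[%classic : set R) = 0%E.
  by apply: measure_negligible I0; exact: measurable_itv.
rewrite lebesgue_measure_itv /= lte_fin ltr01 oppr0 adde0 => /eqP.
by rewrite onee_eq0.
Qed.

(** * Orthonormal frames and projections of circles *)

Lemma dotE3 (R : realType) (x y : 'rV[R]_3) :
  dot x y = x ord0 0 * y ord0 0 + x ord0 1 * y ord0 1 + x ord0 2%:R * y ord0 2%:R.
Proof.
rewrite /dot !big_ord_recl big_ord0 addr0 addrA.
by congr (_ + _ + _); congr (x _ _ * y _ _); apply/val_inj.
Qed.

Lemma dotC (R : realType) (n : nat) (x y : 'rV[R]_n) : dot x y = dot y x.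
Proof. by apply: eq_bigr => i _; rewrite mulrC. Qed.

Lemma dotDl (R : realType) (n : nat) (x y z : 'rV[R]_n) :
  dot (x + y) z = dot x z + dot y z.
Proof. by rewrite -big_split; apply: eq_bigr => i _; rewrite !mxE mulrDl. Qed.

Lemma dotZl (R : realType) (n : nat) (a : R) (x z : 'rV[R]_n) :
  dot (a *: x) z = a * dot x z.
Proof. by rewrite mulr_sumr; apply: eq_bigr => i _; rewrite !mxE mulrA. Qed.

Lemma dotDr (R : realType) (n : nat) (x y z : 'rV[R]_n) :
  dot z (x + y) = dot z x + dot z y.
Proof. by rewrite dotC dotDl !(dotC z). Qed.

Lemma dotZr (R : realType) (n : nat) (a : R) (x z : 'rV[R]_n) :
  dot z (a *: x) = a * dot z x.
Proof. by rewrite dotC dotZl (dotC z). Qed.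

Lemma dotBl (R : realType) (n : nat) (x y z : 'rV[R]_n) :
  dot (x - y) z = dot x z - dot y z.
Proof. by rewrite dotDl -scaleN1r dotZl mulN1r. Qed.

Lemma dot_ge0 (R : realType) (n : nat) (x : 'rV[R]_n) : 0 <= dot x x.
Proof. by apply: sumr_ge0 => i _; rewrite -expr2 sqr_ge0. Qed.

Lemma dot_gt0 (R : realType) (n : nat) (x : 'rV[R]_n) : x != 0 -> 0 < dot x x.
Proof.
move=> x0; rewrite lt_neqAle dot_ge0 andbT eq_sym.
apply: contraNN x0 => /eqP /psumr_eq0P h; apply/eqP/rowP => i; rewrite mxE.
by apply/eqP; rewrite -sqrf_eq0 expr2 h // => j _; rewrite -expr2 sqr_ge0.
Qed.

(** The vector x - (x.e) e has nonnegative square norm. This makes the coordinates along unit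
    vectors 1-Lipschitz. *)
Lemma norm_dot_le (R : realType) (n : nat) (x e : 'rV[R]_n) :
  dot e e = 1 -> `|dot x e| <= enorm x.
Proof.
move=> e1; rewrite -sqrtr_sqr ler_sqrt ?dot_ge0 //.
have := dot_ge0 (x + (- dot x e) *: e).
rewrite !(dotDl, dotDr, dotZl, dotZr) e1 (dotC e x); nra.
Qed.

Lemma exists_orthonormal_frame (R : realType) (v : 'rV[R]_3) : v != 0 ->
  exists e1 e2 e3 : 'rV[R]_3,
  [/\ dot e1 e1 = 1, dot e2 e2 = 1 & dot e3 e3 = 1] /\
  [/\ dot e1 e2 = 0, dot e1 e3 = 0, dot e2 e3 = 0 & exists a, v = a *: e3].
Proof.
have normalize (x : 'rV[R]_3) : x != 0 -> exists2 k, k != 0 & dot (k *: x) (k *: x) = 1.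
  move=> /dot_gt0 x0; have sx : Num.sqrt (dot x x) != 0 by rewrite sqrtr_eq0 -ltNge.
  exists (Num.sqrt (dot x x))^-1; first by rewrite invr_eq0.
  by rewrite dotZl dotZr mulrA -invfM -expr2 sqr_sqrtr ?ltW // mulVf // lt0r_neq0.
pose vec (a b c : R) : 'rV[R]_3 := \row_j nth 0 [:: a; b; c] j.
have vecE a b c (x : 'rV[R]_3) :
    dot (vec a b c) x = a * x ord0 0 + b * x ord0 1 + c * x ord0 2%:R.
  by rewrite dotE3 !mxE.
move=> v0.
have [u u0 uv] : exists2 u : 'rV[R]_3, u != 0 & dot u v = 0.
  have [/eqP v00|v00] := boolP (v ord0 0 == 0).
    exists (vec 1 0 0); last by rewrite vecE v00; ring.
    by apply/eqP => /rowP/(_ 0); rewrite !mxE /= => /eqP; rewrite oner_eq0.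
  exists (vec (- v ord0 1) (v ord0 0) 0); last by rewrite vecE; ring.
  by apply/eqP => /rowP/(_ 1); rewrite !mxE /= => /eqP; rewrite (negPf v00).
have [k k0 e11] := normalize u u0; have [l l0 e33] := normalize v v0.
set e1 := k *: u in e11; set e3 := l *: v in e33.
have e13 : dot e1 e3 = 0 by rewrite dotZl dotZr uv !mulr0.
have vE : v = l^-1 *: e3 by rewrite scalerA mulVf // scale1r.
clearbody e1 e3.
(* The cross product of [e3] and [e1]; its norm comes from Lagrange's identity. *)
pose e2 := vec (e3 ord0 1 * e1 ord0 2%:R - e3 ord0 2%:R * e1 ord0 1)
  (e3 ord0 2%:R * e1 ord0 0 - e3 ord0 0 * e1 ord0 2%:R)
  (e3 ord0 0 * e1 ord0 1 - e3 ord0 1 * e1 ord0 0).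
exists e1, e2, e3; split; split => //.
- have -> : dot e2 e2 = dot e1 e1 * dot e3 e3 - dot e1 e3 ^+ 2.
    by rewrite vecE !dotE3 !mxE /=; ring.
  by rewrite e11 e33 e13 expr0n /=; ring.
- by rewrite dotC vecE; ring.
- by rewrite vecE; ring.
- by exists l^-1.
Qed.

(** The plane normal to [theta] is spanned by [e3] and the unit vector beta (e1 + m e2). Projecting
    along [e3] flattens the circle to a segment of slope [m] whose first coordinate reaches r beta
    to either side of the centre. *)
Lemma circle_projection (R : realType) (e1 e2 e3 c : 'rV[R]_3) (r m : R) :
  [/\ dot e1 e1 = 1, dot e2 e2 = 1 & dot e3 e3 = 1] ->
  [/\ dot e1 e2 = 0, dot e1 e3 = 0 & dot e2 e3 = 0] ->
  0 < r ->
  let beta := (Num.sqrt (1 + m ^+ 2))^-1 in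
  let theta := (- m * beta) *: e1 + beta *: e2 in
  forall x, dot c e1 - r * beta <= x <= dot c e1 + r * beta ->
  exists X, [/\ circle c theta r X, dot X e1 = x &
    dot X e2 = m * x + (dot c e2 - m * dot c e1)].
Proof.
move=> [e11 e22 e33] [e12 e13 e23] r0 beta theta x /andP[x1 x2].
have e21 : dot e2 e1 = 0 by rewrite dotC.
have e31 : dot e3 e1 = 0 by rewrite dotC.
have e32 : dot e3 e2 = 0 by rewrite dotC.
have m1 : 0 < 1 + m ^+ 2 by rewrite ltr_pwDl // sqr_ge0.
have b0 : 0 < beta by rewrite invr_gt0 sqrtr_gt0.
have b2 : beta ^+ 2 * (1 + m ^+ 2) = 1.
  by rewrite exprVn sqr_sqrtr ?ltW // mulVf // lt0r_neq0.
have rb0 : 0 < r * beta by rewrite mulr_gt0.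
pose t := (x - dot c e1) / (r * beta).
have tE : x = dot c e1 + t * (r * beta) by rewrite /t divfK ?lt0r_neq0 // addrC subrK.
have t2 : 0 <= 1 - t ^+ 2.
  have : -1 <= t <= 1 by rewrite /t ler_pdivlMr // ler_pdivrMr //; apply/andP; split; lra.
  by move=> /andP[? ?]; nra.
pose h := Num.sqrt (1 - t ^+ 2).
have h2 : h ^+ 2 = 1 - t ^+ 2 by rewrite sqr_sqrtr.
(* The point of the circle with cosine [t] along beta (e1 + m e2) and sine [h] along [e3]. *)
pose Y := (r * t * beta) *: e1 + (r * t * beta * m) *: e2 + (r * h) *: e3.
have dotE := (dotDl, dotDr, dotZl, dotZr).
exists (c + Y); split.
- have -> : circle c theta r (c + Y) = (dot Y theta = 0 /\ enorm Y = r).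
    by rewrite /circle /= [c + Y]addrC addrK.
  split.
    by rewrite /Y /theta !dotE e11 e22 e12 e21 e31 e32; ring.
  rewrite /enorm (_ : dot Y Y = r ^+ 2); first by rewrite sqrtr_sqr ger0_norm // ltW.
  rewrite /Y !dotE e11 e22 e33 e12 e21 e13 e31 e23 e32.
  transitivity (r ^+ 2 * (t ^+ 2 * (beta ^+ 2 * (1 + m ^+ 2)) + h ^+ 2)); first by ring.
  by rewrite b2 h2; ring.
- by rewrite /Y !dotE e11 e21 e31 tE; ring.
- by rewrite /Y !dotE e12 e22 e32 tE; ring.
Qed.

Theorem theorem1 (R : realType) (v : 'rV[R]_3) (v_neq0 : v != 0)
    (K : set 'rV[R]_3) (K_bounded : bounded_set K)
    (K_circles : forall theta : 'rV[R]_3, equator v theta ->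
      exists (c : 'rV[R]_3) (r : R), 0 < r /\ circle c theta r `<=` K) :
  (2%:E <= hausdorff_dim K)%E.
Proof.
have [e1 [e2 [e3 [unit [e12 e13 e23 [a vE]]]]]] := exists_orthonormal_frame v_neq0.
have [e11 e22 e33] := unit.
have lip e : dot e e = 1 -> forall x y : 'rV[R]_3, `|dot x e - dot y e| <= enorm (x - y).
  by move=> ee x y; rewrite -dotBl norm_dot_le.
apply: le_ereal_inf_tmp => _ [s [s0 K0] <-]; rewrite lee_fin.
apply: (dim_ge2_of_segments (lip e1 e11) (lip e2 e22) _ s0 K0) => m _.
pose beta := (Num.sqrt (1 + m ^+ 2))^-1.
have m1 : 0 < 1 + m ^+ 2 by rewrite ltr_pwDl // sqr_ge0.
have b0 : 0 < beta by rewrite invr_gt0 sqrtr_gt0.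
(* This is the unit normal to lines of slope [m] in the plane of [e1] and [e2]; [beta] normalises
   it, and [v] is a multiple of [e3]. *)
have theta_equator : equator v ((- m * beta) *: e1 + beta *: e2).
  split; last by rewrite vE !(dotDl, dotZl, dotZr) e13 e23; ring.
  rewrite /enorm !(dotDl, dotDr, dotZl, dotZr) e11 e22 e12 (dotC e2) e12.
  rewrite -[RHS]sqrtr1; congr Num.sqrt.
  transitivity (beta ^+ 2 * (1 + m ^+ 2)); first by ring.
  by rewrite exprVn sqr_sqrtr ?ltW // mulVf // lt0r_neq0.
have [c [r [r0 cK]]] := K_circles _ theta_equator.
exists (dot c e2 - m * dot c e1), (dot c e1 - r * beta), (dot c e1 + r * beta).
have rb0 : 0 < r * beta by rewrite mulr_gt0.
split; first by lra.
move=> x hx; have [X [cX X1 X2]] := circle_projection unit (And3 e12 e13 e23) r0 hx.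
by exists X; split => //; exact: cK.
Qed.
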